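(* Let $R$ be a binary predicate symbol and let $\varphi(x):=\bar\exists y\,R(x,y)$. Then the formula $$\big(\forall x((\varphi(x) \to \forall x\,\varphi(x)) \to \forall x\,\varphi(x))\big) \to \forall x\,\varphi(x)$$ does not belong to $\mathsf{InqBQ}$.
   Context: Language: a countably infinite set $\mathsf{Var}$ of individual variables and a countably infinite set $\mathsf{Pred}$ of predicate symbols, each with a fixed arity $m\ge 0$ (no identity, constants or function symbols). Formulas: $\varphi ::= P(x_1,\dots,x_m)\mid \bot\mid \varphi\to\varphi\mid\varphi\wedge\varphi\mid \varphi\veebar\varphi\mid \forall x\varphi\mid \bar\exists x\varphi$, where $\veebar$ is inquisitive disjunction and $\bar\exists$ the inquisitive existential quantifier. A relational information model is $\mathfrak M=(W,D,\mathfrak I)$ with $W$ a nonempty set of worlds, $D$ a nonempty set of individuals, and $\mathfrak I(P,w)\subseteq D^m$ for each $m$-ary $P$ and $w\in W$. A state is any $s\subseteq W$. For $g:\mathsf{Var}\to D$: $\mathfrak M,s\Vdash_g P(x_1,\dots,x_m)$ iff $(g(x_1),\dots,g(x_m))\in\mathfrak I(P,w)$ for all $w\in s$; $\mathfrak M,s\Vdash_g\bot$ iff $s=\varnothing$; $\wedge$ pointwise; $\mathfrak M,s\Vdash_g\varphi\to\psi$ iff for all $t\subseteq s$, $\mathfrak M,t\Vdash_g\varphi$ implies $\mathfrak M,t\Vdash_g\psi$; $\mathfrak M,s\Vdash_g\varphi\veebar\psi$ iff $\mathfrak M,s\Vdash_g\varphi$ or $\mathfrak M,s\Vdash_g\psi$;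 $\mathfrak M,s\Vdash_g\forall x\varphi$ iff $\mathfrak M,s\Vdash_{g[x\mapsto d]}\varphi$ for all $d\in D$; $\mathfrak M,s\Vdash_g\bar\exists x\varphi$ iff $\mathfrak M,s\Vdash_{g[x\mapsto d]}\varphi$ for some $d\in D$. $\mathsf{InqBQ}$ is the set of formulas supported at every state under every assignment in every relational information model. *)

(* Defs.v *)
From mathcomp Require Import all_boot.
From mathcomp Require Import all_classical.

Set Implicit Arguments.
Unset Strict Implicit.
Unset Printing Implicit Defensive.

Local Open Scope classical_set_scope.
Local Open Scope card_scope.

Record language := Language {
  var : eqType;
  pred_symbol : Type;
  arity : pred_symbol -> nat;
  var_countably_infinite : [set: var] #= [set: nat];
  pred_countably_infinite : [set: pred_symbol] #= [set: nat]
}.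

Inductive formula (L : language) : Type :=
| Atom (P : pred_symbol L) of (arity P).-tuple (var L)
| Bot
| Imp of formula L & formula L
| And of formula L & formula L
| InqOr of formula L & formula L
| Forall of var L & formula L
| InqExists of var L & formula L.

Arguments Atom {L} P _.
Arguments Bot {L}.

Record model (L : language) := Model {
  world : Type;
  individual : Type;
  world_nonempty : inhabited world;
  individual_nonempty : inhabited individual;
  interp : forall P : pred_symbol L, world -> set ((arity P).-tuple individual)
}.

Arguments interp {L} m P w _.

Definition assignment (L : language) (M : model L) := var L -> individual M.

Definition update (L : language) (M : model L) (g : assignment M)
    (x : var L) (d : individual M) : assignment M :=
  fun z => if z == x then d else g z.

Fixpoint supports (L : language) (M : model L) (s : set (world M))
    (g : assignment M) (phi : formula L) : Prop :=
  match phi with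
  | Atom P xs => forall w, s w -> interp M P w (map_tuple g xs)
  | Bot => s = set0
  | Imp phi psi =>
      forall t, t `<=` s -> supports t g phi -> supports t g psi
  | And phi psi => supports s g phi /\ supports s g psi
  | InqOr phi psi => supports s g phi \/ supports s g psi
  | Forall x phi => forall d, supports s (update g x d) phi
  | InqExists x phi => exists d, supports s (update g x d) phi
  end.

Definition InqBQ (L : language) : set (formula L) :=
  [set phi | forall (M : model L) (s : set (world M)) (g : assignment M),
    supports s g phi].

(* The cast transports the pair (x, y) along the assumption that R is binary. *)
Definition Atom2 (L : language) (R : pred_symbol L) (R2 : arity R = 2)
    (x y : var L) : formula L :=
  Atom R (tcast (esym R2) [tuple x; y]).

(* Main.v *)
(* Countermodel on the worlds [nat], taken at the full state. For an infinite
   set X of naturals, call a state X-avoiding if it does not contain X; an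
   element of X outside the state witnesses this, so it is expressible as
   [exists y, R(X, y)]. A state avoids all infinite X iff it is finite, and an
   infinite state can always be shrunk to an infinite X-avoiding one by removing
   a single element of X. Hence no infinite state supports the antecedent
   [phi(X) -> forall x phi(x)], whereas finite states support its conclusion. *)

Require Import Defs.
From mathcomp Require Import all_boot.
From mathcomp Require Import all_classical.

Local Open Scope classical_set_scope.

(* [f] stands for the infinite set of all [k + f k]; an individual [g] used as
   second argument of R selects the element of index [g 0]. *)
Definition avoiding_model (L : language) : model L :=
  @Model L nat (nat -> nat) (inhabits 0) (inhabits id)
    (fun P w => [set v | let f := nth id v 0 in let g := nth id v 1 in
                         w <> g 0 + f (g 0)]).

Definition avoids (s : set nat) (f : nat -> nat) : Prop :=
  exists k, ~ s (k + f k).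

(** As [k + h k >= k], a state is infinite iff it fails to avoid some [h]. *)
Lemma infinite_shrink (t : set nat) (f h : nat -> nat) :
  ~ avoids t h ->
  exists u, [/\ u `<=` t, avoids u f & exists h', ~ avoids u h'].
Proof.
move=> th; exists [set n | t n /\ n <> f 0]; split; first by move=> n [].
  by exists 0 => -[_]; rewrite add0n.
(* Index [k] here is index [k + (f 0).+1] of [h], whose element exceeds the removed [f 0]. *)
exists (fun k => (f 0).+1 + h (k + (f 0).+1)) => -[k]; apply; split.
  by rewrite addnA; apply: contrapT => nt; apply: th; exists (k + (f 0).+1).
by move=> /eqP; rewrite addnA addnS addSn eqn_leq leqNgt ltnS addnAC leq_addl.
Qed.

Lemma supports_avoids (L : language) (R : pred_symbol L) (R2 : arity R = 2)
    (x y : var L) (s : set nat) (g : assignment (avoiding_model L)) :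
  x <> y ->
  @supports L (avoiding_model L) s g (InqExists y (Atom2 R2 x y)) <->
  avoids s (g x).
Proof.
move=> /eqP /negbTE neq_xy.
have atomE d w : interp (avoiding_model L) R w
      (map_tuple (update g y d) (tcast (esym R2) [tuple x; y])) <->
    w <> d 0 + g x (d 0).
  by rewrite /= val_tcast /= /update neq_xy eqxx.
split=> [[d sd]|[k sk]].
  by exists (d 0) => sk; have /atomE := sd _ sk.
by exists (fun=> k) => w sw; apply/atomE => wE; apply: sk; rewrite -wE.
Qed.

Theorem theorem3 (L : language) (R : pred_symbol L) (R2 : arity R = 2)
    (x y : var L) (neq_xy : x <> y) :
  let phi := InqExists y (Atom2 R2 x y) in
  ~ InqBQ (Imp (Forall x (Imp (Imp phi (Forall x phi)) (Forall x phi)))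
               (Forall x phi)).
Proof.
move=> phi valid.
have phiE s g d :
    @supports L (avoiding_model L) s (update g x d) phi <-> avoids s d.
  by rewrite supports_avoids// /update eqxx.
pose g0 : assignment (avoiding_model L) := fun=> id.
have /(_ setT (@subsetT _ _)) := valid (avoiding_model L) setT g0.
(* The full state avoids no set, so [id] is an arbitrary choice. *)
case/(_ _ id)/phiE => [d t _ td h|k]; last exact.
apply/phiE; apply: contrapT => th.
(* [u] supports [phi] at [d] but not at [h'], which contradicts [td]. *)
have [u [ut ud [h' uh']]] := infinite_shrink t d h th.
by apply: uh'; apply/phiE; apply: td => //; apply/phiE.
Qed.
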